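(* Consider the semi-discrete scheme $$\boldsymbol U_t=\mathcal{D}(\boldsymbol U,t)\boldsymbol U+\mathcal{L}_{\boldsymbol\delta}\big[\mathcal{B}(\boldsymbol U,t)\boldsymbol U-G(t)\big]+\boldsymbol F(t),\qquad t\ge t_0,$$ where $$\boldsymbol U_t=\frac{d\boldsymbol U}{dt}-\Big(\mathcal{D}_m-\tfrac12\underline{\boldsymbol\nabla\cdot\dot{\boldsymbol X}}\Big)\boldsymbol U .$$ Suppose the same set of partial derivative operators $\mathcal{D}_{x_i}$ is used both in $$\mathcal{D}_m=\tfrac12\sum_{i=1}^p\big(\underline{\dot{\boldsymbol X}}_i\mathcal{D}_{x_i}+\mathcal{D}_{x_i}\underline{\dot{\boldsymbol X}}_i\big)\quad\text{and in}\quad \boldsymbol\nabla\cdot\dot{\boldsymbol X}=\sum_{i=1}^p\mathcal{D}_{x_i}\dot{\boldsymbol X}_i .$$ Assume moreover that $\mathcal{D}_{x_i}\mathbb{1}=0$ for $i=1,\dots,p$, and that for any real number $u_\infty$, with $\boldsymbol U_\infty=u_\infty\mathbb{1}$ and the corresponding choice of data, $$\mathcal{D}(\boldsymbol U_\infty,t)\boldsymbol U_\infty=0,\qquad \mathcal{B}(\boldsymbol U_\infty,t)\boldsymbol U_\infty=G(t),\qquad \boldsymbol F(t)=0 .$$ Then the semi-discrete scheme, and thus equivalently its transformed form for $\hat{\boldsymbol U}=\underline{\sqrt{\mathcal{J}}}\,\boldsymbol U$, $$\frac{d\hat{\boldsymbol U}}{dt}=\hat{\mathcal{D}}\hat{\boldsymbol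 U}+\underline{\sqrt{\mathcal{J}}}\,\mathcal{L}_{\boldsymbol\delta}\big[\hat{\mathcal{B}}\hat{\boldsymbol U}-G(t)\big]+\underline{\sqrt{\mathcal{J}}}\,\boldsymbol F(t),$$ is free-stream preserving.
   Context: Notation: for a vector $\boldsymbol v$, $\underline{\boldsymbol v}=\mathrm{Diag}(\boldsymbol v)$; square roots of vectors are entrywise; $\mathbb{1}\in\mathbb{R}^{n_V}$ is the vector of ones. All quantities may depend on $t$ and hypotheses are for all $t\ge t_0$. Free-stream preserving means that constant solutions are preserved exactly over time: for each real $u_\infty$ (with the corresponding data $G,\boldsymbol F$), if $\boldsymbol U=\boldsymbol U_\infty=u_\infty\mathbb{1}$ at a time $t_1$, then the scheme gives $d\boldsymbol U/dt=0$ there, so the constant function $\boldsymbol U(t)=\boldsymbol U_\infty$ solves the scheme; for the transformed scheme this means $\hat{\boldsymbol U}(t)=u_\infty\sqrt{\mathcal{J}(t)}$ is a solution. Setting: a moving volume mesh has $n_V$ nodes, a subset of $n_S$ of which are surface nodes, with $n_S\times n_V$ restriction matrix $E$ (each row has a single nonzero entry equal to $1$). $\mathcal{P}\in\mathbb{R}^{n_V}$ (positive entries) and $P\in\mathbb{R}^{n_S}$ are volume and surface quadrature weights. The $n_V\times n_V$ matrices $\mathcal{D}_{x_i}$ approximate $\partial/\partial x_i$ and satisfy the summation-by-parts property $\mathcal{D}_{x_i}=\underline{\mathcal{P}}^{-1}\mathcal{Q}_{x_i}$, $\mathcal{Q}_{x_i}+\mathcal{Q}_{x_i}^T=E^T\underline{P}\,\underline{N}_iE$,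 with $N_i\in\mathbb{R}^{n_S}$ the surface node values of the $i$-th normal component. $\dot{\boldsymbol X}_i\in\mathbb{R}^{n_V}$ contains the nodal values of the mesh velocity component $\dot x_i$. $\mathcal{D}(\boldsymbol U,t)$ is $n_V\times n_V$, $\mathcal{B}(\boldsymbol U,t)$ is $n_S\times n_V$, and $\mathcal{L}_{\boldsymbol\delta}=\underline{\mathcal{P}}^{-1}\boldsymbol\delta^T\underline{P}$ for an $n_S\times n_V$ matrix $\boldsymbol\delta$. $\mathcal{P}(t)=\underline{\mathcal{J}(t)}\hat{\mathcal{P}}$ with $\hat{\mathcal{P}}$ constant in time, where $\mathcal{J}(t)\in\mathbb{R}^{n_V}$ is entrywise positive and satisfies $\frac{d\mathcal{J}}{dt}=\big(\underline{\boldsymbol\nabla\cdot\dot{\boldsymbol X}}\big)\mathcal{J}$, $\mathcal{J}(t_0)=\mathcal{J}_0>0$, with the same vector $\boldsymbol\nabla\cdot\dot{\boldsymbol X}$ as in the scheme. Finally $\hat{\mathcal{D}}=\underline{\sqrt{\mathcal{J}}}(\mathcal{D}+\mathcal{D}_m)\underline{\sqrt{\mathcal{J}}}^{-1}$ and $\hat{\mathcal{B}}=\mathcal{B}\,\underline{\sqrt{\mathcal{J}}}^{-1}$ (with $\mathcal{D},\mathcal{B}$ evaluated at $\boldsymbol U=\underline{\sqrt{\mathcal{J}}}^{-1}\hat{\boldsymbol U}$). *)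

(* Defs.v *)
From HB Require Import structures.
From mathcomp Require Import all_boot all_order all_algebra.
From mathcomp Require Import boolp classical_sets reals topology normedtype.
Export numFieldNormedType.Exports.

Set Implicit Arguments.
Unset Strict Implicit.
Unset Printing Implicit Defensive.

Import Order.TTheory GRing.Theory Num.Theory.
Local Open Scope classical_set_scope.
Local Open Scope ring_scope.

Definition Diag (R : realType) (n : nat) (v : 'cV[R]_n) : 'M[R]_n :=
  diag_mx v^T.

Definition sqrtv (R : realType) (n : nat) (v : 'cV[R]_n) : 'cV[R]_n :=
  map_mx Num.sqrt v.

Definition ones (R : realType) (n : nat) : 'cV[R]_n := const_mx 1.

Definition positive_vec (R : realType) (n : nat) (v : 'cV[R]_n) : Prop :=
  forall i, 0 < v i ord0.

(* Time derivative of a function on [t0, +oo[: two-sided for t > t0 and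
   right-sided at t = t0, so values before t0 never matter. *)
Definition is_time_derive (R : realType) (n : nat) (t0 : R)
    (f : R -> 'cV[R]_n) (t : R) (df : 'cV[R]_n) : Prop :=
  (fun h => h^-1 *: (f (t + h) - f t)) @
    within [set h | t0 <= t + h] 0^' --> df.

(* A (possibly nonlinear, time-dependent) system of ODEs is a relation
   eqn t U dU between the time, the state and the time derivative. *)
Definition solves (R : realType) (n : nat) (t0 : R)
    (eqn : R -> 'cV[R]_n -> 'cV[R]_n -> Prop) (U : R -> 'cV[R]_n) : Prop :=
  forall t, t0 <= t ->
    exists2 dU, is_time_derive t0 U t dU & eqn t (U t) dU.

(* Injectivity: the surface nodes are pairwise distinct volume nodes. *)
Definition is_restriction (R : realType) (nS nV : nat)
    (E : 'M[R]_(nS, nV)) : Prop :=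
  exists2 node : 'I_nS -> 'I_nV, injective node &
    E = \matrix_(k, j) (j == node k)%:R.

Definition is_SBP (R : realType) (nS nV : nat) (volP : 'cV[R]_nV)
    (surfP Ni : 'cV[R]_nS) (E : 'M[R]_(nS, nV)) (Dx : 'M[R]_nV) : Prop :=
  exists2 Q : 'M[R]_nV, Dx = invmx (Diag volP) *m Q &
    Q + Q^T = E^T *m Diag surfP *m Diag Ni *m E.

Definition mesh_operator (R : realType) (nV p : nat)
    (Dx : 'I_p -> 'M[R]_nV) (Xdot : 'I_p -> 'cV[R]_nV) : 'M[R]_nV :=
  2^-1 *: \sum_(i < p) (Diag (Xdot i) *m Dx i + Dx i *m Diag (Xdot i)).

Definition mesh_divergence (R : realType) (nV p : nat)
    (Dx : 'I_p -> 'M[R]_nV) (Xdot : 'I_p -> 'cV[R]_nV) : 'cV[R]_nV :=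
  \sum_(i < p) Dx i *m Xdot i.

Record discretization (R : realType) (nV nS : nat) := Discretization {
  volP : R -> 'cV[R]_nV;
  surfP : R -> 'cV[R]_nS;
  opD : 'cV[R]_nV -> R -> 'M[R]_nV;
  opB : 'cV[R]_nV -> R -> 'M[R]_(nS, nV);
  delta : R -> 'M[R]_(nS, nV);
  opDm : R -> 'M[R]_nV;
  divX : R -> 'cV[R]_nV
}.

Definition penalty_lift (R : realType) (nV nS : nat) (S : discretization R nV nS)
    (t : R) : 'M[R]_(nV, nS) :=
  invmx (Diag (volP S t)) *m (delta S t)^T *m Diag (surfP S t).

(* The quantity U_t of the scheme, as a function of U and dU/dt. *)
Definition U_t (R : realType) (nV nS : nat) (S : discretization R nV nS)
    (t : R) (U dU : 'cV[R]_nV) : 'cV[R]_nV :=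
  dU - (opDm S t - 2^-1 *: Diag (divX S t)) *m U.

Definition scheme (R : realType) (nV nS : nat) (S : discretization R nV nS)
    (G : R -> 'cV[R]_nS) (F : R -> 'cV[R]_nV)
    (t : R) (U dU : 'cV[R]_nV) : Prop :=
  U_t S t U dU =
    opD S U t *m U + penalty_lift S t *m (opB S U t *m U - G t) + F t.

Definition hat (R : realType) (nV : nat) (J : R -> 'cV[R]_nV) (t : R)
    (U : 'cV[R]_nV) : 'cV[R]_nV :=
  Diag (sqrtv (J t)) *m U.

Definition unhat (R : realType) (nV : nat) (J : R -> 'cV[R]_nV) (t : R)
    (W : 'cV[R]_nV) : 'cV[R]_nV :=
  invmx (Diag (sqrtv (J t))) *m W.

Definition hatD (R : realType) (nV nS : nat) (S : discretization R nV nS)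
    (J : R -> 'cV[R]_nV) (W : 'cV[R]_nV) (t : R) : 'M[R]_nV :=
  Diag (sqrtv (J t)) *m (opD S (unhat J t W) t + opDm S t)
    *m invmx (Diag (sqrtv (J t))).

Definition hatB (R : realType) (nV nS : nat) (S : discretization R nV nS)
    (J : R -> 'cV[R]_nV) (W : 'cV[R]_nV) (t : R) : 'M[R]_(nS, nV) :=
  opB S (unhat J t W) t *m invmx (Diag (sqrtv (J t))).

Definition hat_scheme (R : realType) (nV nS : nat)
    (S : discretization R nV nS) (J : R -> 'cV[R]_nV)
    (G : R -> 'cV[R]_nS) (F : R -> 'cV[R]_nV)
    (t : R) (W dW : 'cV[R]_nV) : Prop :=
  dW = hatD S J W t *m W
       + Diag (sqrtv (J t)) *m penalty_lift S t *m (hatB S J W t *m W - G t)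
       + Diag (sqrtv (J t)) *m F t.

(* The data G u, F u are those corresponding to the constant state u. *)
Definition free_stream_preserving (R : realType) (nV nS : nat) (t0 : R)
    (S : discretization R nV nS)
    (G : R -> R -> 'cV[R]_nS) (F : R -> R -> 'cV[R]_nV) : Prop :=
  forall u : R,
    (forall (U : R -> 'cV[R]_nV) (t1 : R) (dU : 'cV[R]_nV), t0 <= t1 ->
       U t1 = u *: ones R nV -> is_time_derive t0 U t1 dU ->
       scheme S (G u) (F u) t1 (U t1) dU -> dU = 0) /\
    solves t0 (scheme S (G u) (F u)) (fun=> u *: ones R nV).

Definition hat_free_stream_preserving (R : realType) (nV nS : nat) (t0 : R)
    (S : discretization R nV nS) (J : R -> 'cV[R]_nV)
    (G : R -> R -> 'cV[R]_nS) (F : R -> R -> 'cV[R]_nV) : Prop :=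
  forall u : R,
    solves t0 (hat_scheme S J (G u) (F u)) (fun t => u *: sqrtv (J t)).

(* Main.v *)
Require Import Defs.
From HB Require Import structures.
From mathcomp Require Import all_boot all_order all_algebra.
From mathcomp Require Import boolp classical_sets reals topology normedtype.
From mathcomp Require Import functions filter realfun ring.

(* The free-stream property is the identity D_m 1 = (1/2) div Xdot, which holds
   because D_x 1 = 0 kills half of the skew-symmetric form.  The equivalence of
   the two schemes is d sqrt(J)/dt = (1/2) (div Xdot) sqrt(J): the product rule
   adds (1/2) (div Xdot) to the spatial operator, cancelling the corresponding
   term in U_t. *)

Set Implicit Arguments.
Unset Strict Implicit.
Unset Printing Implicit Defensive.

Import Order.TTheory GRing.Theory Num.Theory.
Local Open Scope classical_set_scope.
Local Open Scope ring_scope.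

(** * Scalar calculus for difference quotients restricted to times in [[t0, +oo[] *)

Section OneSidedDerivative.
Variables (R : realType) (t0 : R).
Implicit Types (f g : R -> R) (t l : R).

Definition admissible_increments t : set_system R :=
  within [set h | t0 <= t + h] 0^'.

(** Properness is not claimed: for [t < t0] no small increment is admissible and the filter contains
    the empty set. The limit rules below need only a filter. *)
#[local] Instance admissible_increments_filter t :
  Filter (admissible_increments t).
Proof. exact: within_filter. Qed.

Definition is_derive_from f t l : Prop :=
  (fun h => h^-1 * (f (t + h) - f t)) @ admissible_increments t --> l.

Lemma is_time_derive_coordP (n : nat) (f : R -> 'cV[R]_n) t (df : 'cV[R]_n) :
  is_time_derive t0 f t df <->
  forall i, is_derive_from (fun s => f s i ord0) t (df i ord0).
Proof.
(* A neighbourhood [A] of a matrix contains a box of entrywise neighbourhoods [P]; finitely many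
   entries can be controlled simultaneously. *)
split=> [cvgf i|cvgf A [P nbhsP PA]].
  have := cvg_comp _ _ cvgf (@coord_continuous _ _ _ i ord0 df).
  by apply: cvg_trans; apply: near_eq_cvg; near=> h; rewrite /= !mxE.
have : \forall h \near admissible_increments t, forall i : 'I_n,
    P i ord0 (h^-1 * (f (t + h) i ord0 - f t i ord0)).
  by apply: filter_forall => i; apply: cvgf; exact: nbhsP.
apply: filterS => h Ph; apply: PA => i j.
by rewrite !mxE (ord1 j); exact: Ph.
Unshelve. all: by end_near. Qed.

Lemma increments_neq0 t : \forall h \near admissible_increments t, h != 0.
Proof. exact: cvg_within (nbhs_dnbhs_neq 0). Qed.

Lemma increments_admissible t :
  \forall h \near admissible_increments t, t0 <= t + h.
Proof. exact: withinT. Qed.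

Lemma cvg_increments t : h @[h --> admissible_increments t] --> (0 : R).
Proof. exact: cvg_within_filter (@nbhs_dnbhs _ 0). Qed.

(** For [h != 0], [f (t + h)] is [f t] plus [h] times the difference quotient, and that product
    tends to [0 * l]. *)
Lemma is_derive_from_cvg f t l : is_derive_from f t l ->
  f (t + h) @[h --> admissible_increments t] --> f t.
Proof.
move=> df; have /(_ _ _ _) := cvgD (cvg_cst (f t)) (cvgM (cvg_increments t) df).
rewrite mul0r addr0; apply: cvg_trans; apply: near_eq_cvg.
near=> h; rewrite !fctE /= mulrA mulfV ?mul1r; first by rewrite subrKC.
by near: h; exact: increments_neq0.
Unshelve. all: by end_near. Qed.

Lemma is_derive_fromM f g t a b :
  is_derive_from f t a -> is_derive_from g t b ->
  is_derive_from (fun s => f s * g s) t (a * g t + f t * b).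
Proof.
move=> df dg.
have /(_ _ _ _ _) :=
  cvgD (cvgM df (is_derive_from_cvg dg)) (cvgM (cvg_cst (f t)) dg).
apply: cvg_trans; apply: near_eq_cvg; near=> h; rewrite !fctE /=; ring.
Unshelve. all: by end_near. Qed.

(* [f] is recovered from [g * f] without differentiating [1 / g]. *)
Lemma is_derive_from_factor f g t a b : (forall s, t0 <= s -> 0 < g s) ->
  t0 <= t -> is_derive_from g t a ->
  is_derive_from (fun s => g s * f s) t b ->
  is_derive_from f t ((b - a * f t) / g t).
Proof.
move=> g_gt0 t0t dg dgf.
(* The increment of [g * f] minus [f t] times that of [g] equals [g (t + h) * (f (t + h) - f t)];
   dividing by [g (t + h)] leaves the increment of [f]. *)
have /(_ _ _ _ _ _) := cvgM (cvgB dgf (cvgM dg (cvg_cst (f t))))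
  (cvgV (lt0r_neq0 (g_gt0 _ t0t)) (is_derive_from_cvg dg)).
apply: cvg_trans; apply: near_eq_cvg; near=> h; rewrite !fctE /=.
field; apply/andP; split.
  by near: h; exact: increments_neq0.
by apply/lt0r_neq0/g_gt0; near: h; exact: increments_admissible.
Unshelve. all: by end_near. Qed.

(** Multiplying by the conjugate turns the quotient of the root into that of [f] over
    [sqrt (f (t + h)) + sqrt (f t)], whose limit is [2 * sqrt (f t)] by continuity. *)
Lemma is_derive_from_sqrt f t a : (forall s, t0 <= s -> 0 < f s) -> t0 <= t ->
  is_derive_from f t a ->
  is_derive_from (fun s => Num.sqrt (f s)) t (a / (2 * Num.sqrt (f t))).
Proof.
move=> f_gt0 t0t df.
have sqrt_gt0 : 0 < Num.sqrt (f t) by rewrite sqrtr_gt0 f_gt0.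
have cvg_sqrt : Num.sqrt (f (t + h)) @[h --> admissible_increments t] -->
    Num.sqrt (f t).
  by apply: continuous_cvg (is_derive_from_cvg df); exact: sqrt_continuous.
rewrite /is_derive_from mulr_natl mulr2n.
have sum_neq0 : Num.sqrt (f t) + Num.sqrt (f t) != 0.
  by rewrite lt0r_neq0 ?addr_gt0.
have /(_ _ _ _ _) :=
  cvgM df (cvgV sum_neq0 (cvgD cvg_sqrt (cvg_cst (Num.sqrt (f t))))).
apply: cvg_trans; apply: near_eq_cvg; near=> h; rewrite !fctE /=.
have fh_gt0 : 0 < f (t + h).
  by apply: f_gt0; near: h; exact: increments_admissible.
have h_neq0 : h != 0 by near: h; exact: increments_neq0.
(* With values of [f] written as squares of their roots, the goal is a rational identity in the
   roots and [h]. *)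
rewrite -{1}(sqr_sqrtr (ltW fh_gt0)) -{1}(sqr_sqrtr (ltW (f_gt0 _ t0t))).
field; rewrite h_neq0 /= lt0r_neq0 // ltr_wpDl ?sqrtr_ge0 //.
Unshelve. all: by end_near. Qed.

End OneSidedDerivative.

Lemma is_time_derive_cst (R : realType) (n : nat) (t0 t : R) (v : 'cV[R]_n) :
  is_time_derive t0 (fun=> v) t 0.
Proof.
rewrite /is_time_derive; under eq_fun do rewrite subrr scaler0.
exact: cvg_cst.
Qed.

Section DiagonalMatrices.
Variables (R : realType) (n : nat).
Implicit Types u v : 'cV[R]_n.

Lemma mul_DiagE v u i : (Diag v *m u) i ord0 = v i ord0 * u i ord0.
Proof. by rewrite mul_diag_mx !mxE. Qed.

Lemma addZ_mul_DiagE a u v w i :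
  (u + a *: Diag v *m w) i ord0 = u i ord0 + a * (v i ord0 * w i ord0).
Proof. by rewrite -scalemxAl -mul_DiagE !mxE. Qed.

Lemma Diag_ones v : Diag v *m ones R n = v.
Proof.
by apply/matrixP => i j; rewrite ord1 mul_DiagE /ones mxE mulr1.
Qed.

Lemma Diag_unit v : positive_vec v -> Diag v \in unitmx.
Proof.
move=> v_gt0; rewrite unitmxE det_diag unitfE; apply/prodf_neq0 => i _.
by rewrite mxE lt0r_neq0.
Qed.

Lemma sqrtv_gt0 v : positive_vec v -> positive_vec (sqrtv v).
Proof. by move=> v_gt0 i; rewrite mxE sqrtr_gt0. Qed.

End DiagonalMatrices.

(** In each summand [Diag (Xdot i) *m Dx i] annihilates [ones], while [Dx i *m Diag (Xdot i)] sends
    it to [Dx i *m Xdot i]. *)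
Lemma mesh_operator_ones (R : realType) (n p : nat) (Dx : 'I_p -> 'M[R]_n)
    (Xdot : 'I_p -> 'cV[R]_n) : (forall i, Dx i *m ones R n = 0) ->
  mesh_operator Dx Xdot *m ones R n = 2^-1 *: mesh_divergence Dx Xdot.
Proof.
move=> Dx1; rewrite /mesh_operator -scalemxAl mulmx_suml; congr (_ *: _).
apply: eq_bigr => i _.
by rewrite mulmxDl -!mulmxA Dx1 mulmx0 add0r Diag_ones.
Qed.

(** * The change of variable by the square root of [J] *)

Section Transformation.
Variables (R : realType) (n : nat) (t0 : R) (J : R -> 'cV[R]_n).
Hypothesis J_gt0 : forall t, t0 <= t -> positive_vec (J t).

Lemma hatK t U : t0 <= t -> unhat J t (hat J t U) = U.
Proof.
by move=> t0t; rewrite /unhat /hat mulKmx // Diag_unit //; exact/sqrtv_gt0/J_gt0.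
Qed.

Lemma unhatK t W : t0 <= t -> hat J t (unhat J t W) = W.
Proof.
by move=> t0t; rewrite /unhat /hat mulKVmx // Diag_unit //; exact/sqrtv_gt0/J_gt0.
Qed.

Lemma hatE t U i : hat J t U i ord0 = sqrtv (J t) i ord0 * U i ord0.
Proof. exact: mul_DiagE. Qed.

(** Pure algebra at a fixed time, with [U] and [dU] arbitrary vectors: the transformed equation is
    the original one multiplied by the invertible [Diag (sqrtv (J t))]. *)
Lemma hat_schemeP (m : nat) (S : discretization R n m) (g : R -> 'cV[R]_m)
    (f : R -> 'cV[R]_n) t U dU : t0 <= t ->
  scheme S g f t U dU <->
  hat_scheme S J g f t (hat J t U) (hat J t (dU + 2^-1 *: Diag (divX S t) *m U)).
Proof.
move=> t0t; rewrite /hat_scheme /hatD /hatB hatK //.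
rewrite -!(mulmxA _ (invmx _)) -/(unhat J t _) hatK // -!(mulmxA (Diag _)) -!mulmxDr.
rewrite /scheme /U_t mulmxBl mulmxDl.
set lift := penalty_lift S t *m _; set DmU := opDm S t *m U.
set DU := opD S U t *m U; set divU := (_ *: _) *m U.
(* Both equations have the same residual once the mesh terms of [U_t] change sides. *)
have shift : dU - (DmU - divU) - (DU + lift + f t) =
    dU + divU - (DU + DmU + lift + f t).
  by apply/matrixP => i j; rewrite !mxE; ring.
split=> [/eqP|/(congr1 (unhat J t))].
  by rewrite -subr_eq0 shift subr_eq0 => /eqP ->.
rewrite -/(hat J t _) !hatK // => /eqP.
by rewrite -subr_eq0 -shift subr_eq0 => /eqP.
Qed.

Variable dv : R -> 'cV[R]_n.
Hypothesis J_ode : forall t, t0 <= t -> is_time_derive t0 J t (Diag (dv t) *m J t).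

Lemma sqrtv_derive_from t i : t0 <= t ->
  is_derive_from t0 (fun s => sqrtv (J s) i ord0) t
    (2^-1 * dv t i ord0 * sqrtv (J t) i ord0).
Proof.
move=> t0t; have /is_time_derive_coordP/(_ i) dJ := J_ode t0t.
have := is_derive_from_sqrt (fun s t0s => J_gt0 t0s i) t0t dJ.
have sqrt_gt0 : 0 < Num.sqrt (J t i ord0) by rewrite sqrtr_gt0 J_gt0.
have -> : (fun s => sqrtv (J s) i ord0) = fun s => Num.sqrt (J s i ord0).
  by apply/funext => s; rewrite mxE.
rewrite mul_DiagE [in X in _ -> X]mxE; congr is_derive_from.
(* The factor [J] supplied by its ODE is the square of its root, so one root cancels against the
   denominator. *)
rewrite -{1}(sqr_sqrtr (ltW (J_gt0 t0t i))); field.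
by rewrite lt0r_neq0.
Qed.

(** Forwards this is the product rule in each coordinate. Backwards, differentiability of [U] itself
    has to be recovered, by dividing out the positive factor [sqrtv (J s)]. *)
Lemma is_time_derive_hat (U : R -> 'cV[R]_n) t dU : t0 <= t ->
  is_time_derive t0 U t dU <->
  is_time_derive t0 (fun s => hat J s (U s)) t
    (hat J t (dU + 2^-1 *: Diag (dv t) *m U t)).
Proof.
move=> t0t; rewrite !is_time_derive_coordP; split=> dU_ i.
  have := is_derive_fromM (sqrtv_derive_from (i := i) t0t) (dU_ i).
  have -> : (fun s => hat J s (U s) i ord0) =
      fun s => sqrtv (J s) i ord0 * U s i ord0.
    by apply/funext => s; rewrite hatE.
  congr is_derive_from.
  rewrite hatE addZ_mul_DiagE; ring.
have s_gt0 s (t0s : t0 <= s) := sqrtv_gt0 (J_gt0 t0s) i.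
have := dU_ i.
have -> : (fun s => hat J s (U s) i ord0) =
    fun s => sqrtv (J s) i ord0 * U s i ord0.
  by apply/funext => s; rewrite hatE.
move=> /(is_derive_from_factor s_gt0 t0t (sqrtv_derive_from (i := i) t0t)).
congr is_derive_from.
rewrite hatE addZ_mul_DiagE; field.
by rewrite lt0r_neq0 // s_gt0.
Qed.

End Transformation.

Theorem proposition4p1 (R : realType) (nV nS p : nat) (t0 : R)
    (sd : discretization R nV nS)
    (E : R -> 'M[R]_(nS, nV)) (N : 'I_p -> R -> 'cV[R]_nS)
    (Dx : 'I_p -> R -> 'M[R]_nV) (Xdot : 'I_p -> R -> 'cV[R]_nV)
    (Phat J0 : 'cV[R]_nV) (J : R -> 'cV[R]_nV)
    (G : R -> R -> 'cV[R]_nS) (F : R -> R -> 'cV[R]_nV)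
    (volP_gt0 : forall t : R, t0 <= t -> positive_vec (volP sd t))
    (E_restr : forall t : R, t0 <= t -> is_restriction (E t))
    (Dx_SBP : forall (i : 'I_p) (t : R), t0 <= t ->
       is_SBP (volP sd t) (surfP sd t) (N i t) (E t) (Dx i t))
    (J_gt0 : forall t : R, t0 <= t -> positive_vec (J t))
    (volP_J : forall t : R, t0 <= t -> volP sd t = Diag (J t) *m Phat)
    (J_ode : forall t : R, t0 <= t ->
       is_time_derive t0 J t (Diag (divX sd t) *m J t))
    (J_init : J t0 = J0) (J0_gt0 : positive_vec J0)
    (Dm_def : forall t : R, t0 <= t ->
       opDm sd t = mesh_operator (fun i => Dx i t) (fun i => Xdot i t))
    (divX_def : forall t : R, t0 <= t ->
       divX sd t = mesh_divergence (fun i => Dx i t) (fun i => Xdot i t))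
    (Dx_ones : forall (i : 'I_p) (t : R), t0 <= t -> Dx i t *m ones R nV = 0)
    (D_const : forall u t : R, t0 <= t ->
       opD sd (u *: ones R nV) t *m (u *: ones R nV) = 0)
    (B_const : forall u t : R, t0 <= t ->
       opB sd (u *: ones R nV) t *m (u *: ones R nV) = G u t)
    (F_const : forall u t : R, t0 <= t -> F u t = 0) :
  [/\ free_stream_preserving t0 sd G F,
      (forall (g : R -> 'cV[R]_nS) (f : R -> 'cV[R]_nV)
              (U : R -> 'cV[R]_nV),
         solves t0 (scheme sd g f) U <->
         solves t0 (hat_scheme sd J g f) (fun t => hat J t (U t))) &
      hat_free_stream_preserving t0 sd J G F].
Proof.
have Dm_ones t : t0 <= t ->
    opDm sd t *m ones R nV = 2^-1 *: divX sd t.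
  by move=> t0t; rewrite Dm_def // divX_def // mesh_operator_ones // => i; exact: Dx_ones.
(* On a constant state the right-hand side vanishes and the two mesh terms of [U_t] cancel by
   [Dm_ones]. This yields both halves of free-stream preservation. *)
have scheme_cst u t dU : t0 <= t ->
    scheme sd (G u) (F u) t (u *: ones R nV) dU <-> dU = 0.
  move=> t0t; rewrite /scheme /U_t F_const // D_const // B_const //.
  rewrite subrr mulmx0 !addr0 mulmxBl -!scalemxAr Dm_ones //.
  by rewrite -scalemxAl Diag_ones subrr subr0.
have transformed g f U : solves t0 (scheme sd g f) U <->
    solves t0 (hat_scheme sd J g f) (fun t => hat J t (U t)).
  split=> solU t t0t; have [dU dU_ eqU] := solU t t0t.
    exists (hat J t (dU + 2^-1 *: Diag (divX sd t) *m U t)).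
      exact: (is_time_derive_hat J_gt0 J_ode U dU t0t).1.
    exact: (hat_schemeP J_gt0 sd g f (U t) dU t0t).1.
  (* The derivative of [U] is found by solving the product rule for it, given the derivative [dU] of
     the transformed solution. *)
  pose dV := unhat J t dU - 2^-1 *: Diag (divX sd t) *m U t.
  have dUE : dU = hat J t (dV + 2^-1 *: Diag (divX sd t) *m U t).
    by rewrite subrK (unhatK J_gt0).
  rewrite dUE in dU_ eqU; exists dV.
    exact: (is_time_derive_hat J_gt0 J_ode U dV t0t).2.
  exact: (hat_schemeP J_gt0 sd g f (U t) dV t0t).2.
have cst_solves u : solves t0 (scheme sd (G u) (F u)) (fun=> u *: ones R nV).
  move=> t t0t; exists 0; first exact: is_time_derive_cst.
  exact/scheme_cst.
split=> // u.
  split=> // U t dU t0t -> _ dUE; exact: (scheme_cst _ _ _ t0t).1 dUE.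
(* The transformed solution is the image of the constant one. *)
have /transformed := cst_solves u.
suff -> : (fun t => hat J t (u *: ones R nV)) = (fun t => u *: sqrtv (J t)) by [].
by apply/funext => t; rewrite /hat -scalemxAr Diag_ones.
Qed.
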